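(* Assume the Axiom of Choice. Let $X,Y$ be nonempty sets and let $F\colon X^*\to Y$ be a function. The following assertions are equivalent. (i) $F$ is strongly B-preassociative and arity-wise quasi-range-idempotent. (ii) There exist a strongly B-associative $\varepsilon$-standard operation $H\colon X^*\to X\cup\{\varepsilon\}$ and a sequence $(f_n)_{n\geqslant 1}$ of one-to-one functions $f_n\colon\mathrm{ran}(H_n)\to Y$ such that $F_n=f_n\circ H_n$ for every $n\geqslant 1$. If condition (ii) holds, then for every $n\geqslant 1$ we have $F_n=\delta_{F_n}\circ H_n$, $f_n=\delta_{F_n}|_{\mathrm{ran}(H_n)}$, $f_n^{-1}\in Q(\delta_{F_n})$, and we may choose $H_n=g_n\circ F_n$ for any $g_n\in Q(\delta_{F_n})$ (that is, for any choice of $g_n\in Q(\delta_{F_n})$, $n\geqslant 1$, the $\varepsilon$-standard operation $H$ with $H_n=g_n\circ F_n$ for all $n\geqslant 1$ satisfies (ii) for suitable $f_n$).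
   Context: $X^*=\bigcup_{n\geqslant 0}X^n$ is the set of all strings (finite words) over $X$, with $X^0=\{\varepsilon\}$, where $\varepsilon$ is the empty string (not a letter of $X$). Concatenation is written by juxtaposition, $|\mathbf{x}|$ is the length of $\mathbf{x}$, and $\mathbf{x}^n$ is the concatenation of $n$ copies of $\mathbf{x}$. For a function $F$ on $X^*$, $F_n=F|_{X^n}$ is its $n$-ary part, and for $n\geqslant 1$, $\delta_{F_n}\colon X\to Y$ is defined by $\delta_{F_n}(x)=F_n(x^n)$. For $\mathbf{x}=x_1\cdots x_n\in X^n$ and $K\subseteq\{1,\ldots,n\}$, $\mathbf{x}|_K$ is the string obtained from $\mathbf{x}$ by removing all letters $x_i$ with $i\notin K$. $\mathrm{ran}$ and $\mathrm{dom}$ denote range and domain. $F\colon X^*\to Y$ is strongly B-preassociative if for every $\mathbf{x}\in X^*$, every $\mathbf{x}'\in X^{|\mathbf{x}|}$ and every $K\subseteq\{1,\ldots,|\mathbf{x}|\}$ with complement $K^c$: $F(\mathbf{x}|_K)=F(\mathbf{x}'|_K)$ and $\mathbf{x}'|_{K^c}=\mathbf{x}|_{K^c}$ imply $F(\mathbf{x})=F(\mathbf{x}')$. $F$ is arity-wise quasi-range-idempotent if $\mathrm{ran}(\delta_{F_n})=\mathrm{ran}(F_n)$ for every $n\geqslant 1$. An operation $H\colon X^*\to X\cup\{\varepsilon\}$ is $\varepsilon$-standard if $H(\mathbf{x})=\varepsilon\Leftrightarrow\mathbf{x}=\varepsilon$. It is strongly B-associative if for every $\mathbf{x}\in X^*$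 and every $K\subseteq\{1,\ldots,|\mathbf{x}|\}$ we have $H(\mathbf{x})=H(\mathbf{x}')$, where $\mathbf{x}'$ is the string obtained from $\mathbf{x}$ by replacing each letter $x_i$, $i\in K$, by $H(\mathbf{x}|_K)$ and keeping the letters $x_i$, $i\notin K$, unchanged. A function $g$ is a quasi-inverse of a function $f$ if $f\circ g|_{\mathrm{ran}(f)}=\mathrm{id}_{\mathrm{ran}(f)}$ and $\mathrm{ran}(g|_{\mathrm{ran}(f)})=\mathrm{ran}(g)$ (so $\mathrm{ran}(f)\subseteq\mathrm{dom}(g)$ and $g$ takes values in $\mathrm{dom}(f)$). $Q(f)$ denotes the set of all quasi-inverses of $f$. *)

(* Defs.v *)
From mathcomp Require Import all_boot.
From mathcomp Require Import boolp classical_sets.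

Set Implicit Arguments.
Unset Strict Implicit.
Unset Printing Implicit Defensive.

Local Open Scope classical_set_scope.

(* Conventions: X^* is [seq X]; X \cup {epsilon} is [option X], with [None] for
   epsilon.  A subset [A : set T] used as a type is its subtype [set_type A], so
   that a function on ran(f) has type [range f -> _].  Positions are 'I_n. *)

Definition npart X Y (F : seq X -> Y) (n : nat) : n.-tuple X -> Y :=
  fun x => F x.

Definition delta X Y (F : seq X -> Y) (n : nat) : X -> Y :=
  fun a => npart F (nseq_tuple n a).

(* [enum K] lists K in increasing order *)
Definition substring X n (x : n.-tuple X) (K : {set 'I_n}) : seq X :=
  [seq tnth x i | i <- enum K].

Definition strongly_Bpreassociative X Y (F : seq X -> Y) : Prop :=
  forall (n : nat) (x x' : n.-tuple X) (K : {set 'I_n}),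
    F (substring x K) = F (substring x' K) ->
    substring x' (~: K)%SET = substring x (~: K)%SET ->
    F x = F x'.

Definition aw_quasi_range_idempotent X Y (F : seq X -> Y) : Prop :=
  forall n : nat, 0 < n -> range (delta F n) = range (@npart X Y F n).

Definition eps_standard X (H : seq X -> option X) : Prop :=
  forall x : seq X, H x = None <-> x = [::].

Definition string_of_option X (o : option X) : seq X :=
  if o is Some a then [:: a] else [::].

(* Replacing by epsilon ([o = None]) erases the letter. *)
Definition replace X n (x : n.-tuple X) (K : {set 'I_n}) (o : option X) :
    seq X :=
  flatten [seq if i \in K then string_of_option o else [:: tnth x i]
          | i <- enum 'I_n].

Definition strongly_Bassociative X (H : seq X -> option X) : Prop :=
  forall (n : nat) (x : n.-tuple X) (K : {set 'I_n}),
    H x = H (replace x K (H (substring x K))).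

Definition corestrict A B (f : A -> B) (a : A) : range f :=
  SigSub (mem_set (imageT f a)).

(* [quasi_inverse f g] is g \in Q(f), where dom(g) = D may be any subset of
   the codomain of f containing ran(f). *)
Definition quasi_inverse A B (f : A -> B) (D : set B) (g : D -> A) : Prop :=
  [/\ range f `<=` D,
      forall y : D, range f (val y) -> f (g y) = val y
    & g @` [set y : D | range f (val y)] = range g].

(* F_n = f_n o H_n for n >= 1; the component [f 0] plays no role. *)
Definition factorization X Y (F : seq X -> Y) (H : seq X -> option X)
    (f : forall n : nat, range (@npart X (option X) H n) -> Y) : Prop :=
  [/\ strongly_Bassociative H,
      eps_standard H,
      forall n : nat, 0 < n -> injective (f n)
    & forall n : nat, 0 < n ->
        @npart X Y F n =1 f n \o corestrict (@npart X (option X) H n)].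

(* Main.v *)
(* For [n > 0], F_n and H_n have the same kernel, because the f_n are
   injective.  Strong B-associativity with K = {1..n} gives
   H_n(x) = H_n(H_n(x)^n), hence F_n = delta_{F_n} o H_n.  Conversely, if g_n
   selects preimages under delta_{F_n}, then H_n := g_n o F_n satisfies
   F(x|_K) = F(H(x|_K)^|K|), so by strong
   B-preassociativity replacing the letters of x|_K by H(x|_K) does not change
   F(x). *)

Require Import Defs.
From mathcomp Require Import all_boot.
From mathcomp Require Import boolp classical_sets.

Set Implicit Arguments.
Unset Strict Implicit.
Unset Printing Implicit Defensive.

Lemma eq_substringP (X : Type) (n : nat) (x x' : n.-tuple X) (K : {set 'I_n}) :
  substring x K = substring x' K <-> {in K, tnth x =1 tnth x'}.
Proof.
split=> [/eq_in_map eqxx' i iK | eqxx'].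
  by apply: eqxx'; rewrite mem_enum.
by apply/eq_in_map => i; rewrite mem_enum; apply: eqxx'.
Qed.

Lemma size_substring (X : Type) (n : nat) (x : n.-tuple X) (K : {set 'I_n}) :
  size (substring x K) == #|K|.
Proof. by rewrite size_map -cardE. Qed.

Lemma substring_const (X : Type) (n : nat) (x : n.-tuple X) (K : {set 'I_n})
    (a : X) :
  {in K, forall i, tnth x i = a} -> substring x K = nseq #|K| a.
Proof.
move=> xK; have -> : substring x K = [seq a | _ <- enum K].
  by apply/eq_in_map => i; rewrite mem_enum; apply: xK.
by rewrite cardE; elim: (enum K) => //= i s ->.
Qed.

Lemma substringT (X : Type) (n : nat) (x : n.-tuple X) :
  substring x finset.setT = x.
Proof. by rewrite /substring enum_setT -enumT map_tnth_enum. Qed.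

Lemma replace0 (X : Type) (n : nat) (x : n.-tuple X) (o : option X) :
  replace x finset.set0 o = x.
Proof.
rewrite /replace (eq_map (g := fun i => [:: tnth x i])).
  by rewrite flatten_map1 map_tnth_enum.
by move=> i; rewrite inE.
Qed.

Lemma replace_some (X : Type) (n : nat) (x : n.-tuple X) (K : {set 'I_n})
    (a : X) :
  replace x K (Some a) = [tuple (if i \in K then a else tnth x i) | i < n].
Proof.
rewrite /replace (eq_map (g := fun i => [:: if i \in K then a else tnth x i])).
  by rewrite flatten_map1 -[RHS]/(map _ (enum 'I_n)).
by move=> i /=; case: ifP.
Qed.

Lemma replaceT (X : Type) (n : nat) (x : n.-tuple X) (a : X) :
  replace x finset.setT (Some a) = nseq n a.
Proof.
rewrite replace_some -[nseq n a]/(tval (nseq_tuple n a)); congr tval.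
by apply: eq_from_tnth => i; rewrite tnth_mktuple inE tnth_nseq.
Qed.

Lemma eps_standardE (X : Type) (H : seq X -> option X) (x : seq X) :
  eps_standard H -> 0 < size x -> exists a, H x = Some a.
Proof.
move=> epsH x_gt0; case Hx: (H x) => [a|]; first by exists a.
by move/epsH: Hx x_gt0 => ->.
Qed.

(** Moves equalities between [F] and [H] at any positive arity; it is used both at the length of a
    string and at the length of a substring. *)
Lemma factorization_kernel (X Y : Type) (F : seq X -> Y)
    (H : seq X -> option X)
    (f : forall n : nat, range (@npart X (option X) H n) -> Y)
    (n : nat) (x x' : n.-tuple X) :
  factorization F f -> 0 < n -> F x = F x' <-> H x = H x'.
Proof.
case=> _ _ injf Ff n_gt0.
have Fx := Ff n n_gt0 x; have Fx' := Ff n n_gt0 x'.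
rewrite /npart /= in Fx Fx'; rewrite Fx Fx'.
split=> [/(injf n n_gt0) /(congr1 val) // | Hxx'].
by congr (f n _); apply: val_inj.
Qed.

Arguments factorization_kernel {X Y F H f n} x x'.

Lemma Bassociative_idem (X : Type) (H : seq X -> option X) (n : nat)
    (x : n.-tuple X) (a : X) :
  strongly_Bassociative H -> H x = Some a -> H (nseq n a) = Some a.
Proof.
by move=> assH Hx; rewrite -Hx (assH _ x finset.setT) substringT Hx replaceT.
Qed.

Lemma factorization_delta (X Y : Type) (F : seq X -> Y)
    (H : seq X -> option X)
    (f : forall n : nat, range (@npart X (option X) H n) -> Y)
    (n : nat) (x : n.-tuple X) (a : X) :
  factorization F f -> 0 < n -> H x = Some a -> F x = delta F n a.
Proof.
move=> fac n_gt0 Hx; apply/(factorization_kernel _ _ fac n_gt0).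
by case: fac => assH _ _ _; rewrite Hx (@Bassociative_idem _ _ _ x).
Qed.

(** Equality of [F] on the two substrings passes to [H] at arity [#|K|]. Strong B-associativity then
    lets both strings be rewritten with one common letter on [K]. *)
Lemma factorization_preassociative (X Y : Type) (F : seq X -> Y)
    (H : seq X -> option X)
    (f : forall n : nat, range (@npart X (option X) H n) -> Y) :
  factorization F f -> strongly_Bpreassociative F.
Proof.
move=> fac n x x' K FK /eq_substringP eqC; have [assH epsH _ _] := fac.
have [K0|[k kK]] := set_0Vmem K.
  congr F; congr tval; apply: eq_from_tnth => i.
  by rewrite eqC // K0 !inE.
have n_gt0 : 0 < n by apply: leq_ltn_trans (ltn_ord k).
have K_gt0 : 0 < #|K| by apply/card_gt0P; exists k.
apply/(factorization_kernel _ _ fac n_gt0).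
have HK : H (substring x K) = H (substring x' K).
  exact/(factorization_kernel (Tuple (size_substring x K))
                              (Tuple (size_substring x' K)) fac K_gt0).
have [|a Ha] := eps_standardE (x := substring x K) epsH.
  by rewrite (eqP (size_substring x K)).
(* After replacement both strings carry [a] on [K], and they already agree off [K], so they
   coincide. *)
rewrite (assH _ x K) (assH _ x' K) -HK Ha !replace_some.
congr H; congr tval; apply: eq_from_tnth => i; rewrite !tnth_mktuple.
by case: ifPn => // iK; rewrite eqC // inE.
Qed.

Lemma factorization_range_idempotent (X Y : Type) (F : seq X -> Y)
    (H : seq X -> option X)
    (f : forall n : nat, range (@npart X (option X) H n) -> Y) :
  factorization F f -> aw_quasi_range_idempotent F.
Proof.
move=> fac n n_gt0; apply/seteqP; split=> [_ [a _ <-] | _ [x _ <-]].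
  exact: imageT.
have [_ epsH _ _] := fac.
have [|a Hx] := eps_standardE (x := x) epsH; first by rewrite size_tuple.
by exists a; rewrite // /npart (factorization_delta fac n_gt0 Hx).
Qed.

(** This is [H] with [H_n = g_n o F_n]. The separate empty case makes it epsilon-standard, and [g]
    depends on the length because preimages are selected arity by arity. *)
Definition lift_selection (X Y : Type) (F : seq X -> Y) (g : nat -> Y -> X)
    (x : seq X) : option X :=
  if x is [::] then None else Some (g (size x) (F x)).

Lemma lift_selectionE (X Y : Type) (F : seq X -> Y) (g : nat -> Y -> X)
    (n : nat) (x : n.-tuple X) :
  0 < n -> lift_selection F g x = Some (g n (F x)).
Proof.
by move=> n_gt0; case: x => -[|b x] /= /eqP sz; rewrite -sz // in n_gt0 *.
Qed.

Lemma lift_selection_factorization (X Y : Type) (F : seq X -> Y)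
    (g : nat -> Y -> X) :
  strongly_Bpreassociative F ->
  (forall (n : nat) (x : n.-tuple X), 0 < n -> delta F n (g n (F x)) = F x) ->
  exists f : forall n : nat,
      range (@npart X (option X) (lift_selection F g) n) -> Y,
    factorization F f.
Proof.
move=> preF gK; set H := lift_selection F g.
(* The value [F [::]] is reached only at [n = 0]. *)
exists (fun n z => if val z is Some a then delta F n a else F [::]).
split.
- move=> n x K; have [->|[k kK]] := set_0Vmem K; first by rewrite replace0.
  have n_gt0 : 0 < n by apply: leq_ltn_trans (ltn_ord k).
  have K_gt0 : 0 < #|K| by apply/card_gt0P; exists k.
  pose y := Tuple (size_substring x K).
  rewrite -[substring x K]/(tval y) [H y]lift_selectionE // replace_some.
  set a := g _ _; rewrite /H !lift_selectionE //; congr (Some (g n _)).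
  (* On [K] the replaced string is constant with letter [a], and [gK] at arity [#|K|] says that [F]
     does not distinguish [a] repeated [#|K|] times from [y]. *)
  apply: (preF n x _ K).
    transitivity (F (nseq #|K| a)); first by rewrite -[LHS]/(F y) -gK.
    by rewrite (@substring_const _ _ _ _ a) // => i iK; rewrite tnth_mktuple iK.
  apply/eq_substringP => i; rewrite inE tnth_mktuple.
  by move/negbTE ->.
- by case.
(* By [gK], applying [delta F n] to the letter of [H x] gives back [F x], which in turn determines
   [H x]. *)
- move=> n n_gt0 [z zP] [z' z'P] /= eqzz'; apply: val_inj => /=.
  move: (set_mem zP) (set_mem z'P) eqzz' => [x _ <-] [x' _ <-].
  by rewrite /npart /H !lift_selectionE // !gK // => ->.
- by move=> n n_gt0 x /=; rewrite /npart /H lift_selectionE // gK.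
Qed.

(** Since [f n] is [delta F n] on the letters of ran(H_n), inverting [f n] selects a preimage under
    [delta F n]. *)
Lemma factorization_quasi_inverse (X Y : Type) (F : seq X -> Y)
    (H : seq X -> option X)
    (f : forall n : nat, range (@npart X (option X) H n) -> Y) (n : nat) :
  factorization F f -> 0 < n ->
  exists2 g : range (f n) -> X,
    forall z : range (@npart X (option X) H n),
      Some (g (corestrict (f n) z)) = val z
    & quasi_inverse (delta F n) g.
Proof.
move=> fac n_gt0; have [_ epsH injf Ff] := fac.
have f_delta z : exists2 a, val z = Some a & f n z = delta F n a.
  have [x _ Hx] := set_mem (valP z).
  have [|a Ha] := eps_standardE (x := x) epsH; first by rewrite size_tuple.
  exists a; first by rewrite -Hx.
  rewrite -(factorization_delta fac n_gt0 Ha).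
  by rewrite -[F x]/(npart F x) (Ff n) //=; congr (f n _); apply: val_inj.
have /choice[g gP] (y : range (f n)) :
    exists a, exists2 z, val z = Some a & f n z = val y.
  have [z _ fz] := set_mem (valP y).
  by have [a za _] := f_delta z; exists a, z.
have deltag y : delta F n (g y) = val y.
  by have [z za <-] := gP y; have [b] := f_delta z; rewrite za => -[<-].
exists g.
  (* Injectivity of [f n] identifies the point chosen over [f n z] with [z] itself. *)
  by move=> z; have [z' <- /(injf n n_gt0) ->] := gP (corestrict (f n) z).
split.
- move=> _ [a _ <-]; exists (corestrict (@npart X _ H n) (nseq_tuple n a)) => //.
  by rewrite -[RHS]/(npart F _) (Ff n).
- by move=> y _; apply: deltag.
- apply/seteqP; split=> [_ [y _ <-] | _ [y _ <-]]; first exact: imageT.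
  (* By [deltag] every point of the domain of [g] lies in the range of [delta F n], so restricting
     to that range loses no value. *)
  by exists y; rewrite //= -deltag; apply: imageT.
Qed.

Theorem corollary2p12 (X Y : Type) (hX : inhabited X) (hY : inhabited Y)
    (F : seq X -> Y) :
  ((strongly_Bpreassociative F /\ aw_quasi_range_idempotent F)
   <->
   (exists (H : seq X -> option X)
           (f : forall n : nat, range (@npart X (option X) H n) -> Y),
      factorization F f))
  /\
  (forall (H : seq X -> option X)
          (f : forall n : nat, range (@npart X (option X) H n) -> Y),
     factorization F f ->
     (forall n : nat, 0 < n ->
        [/\ (* F_n = delta_{F_n} o H_n *)
            forall x : n.-tuple X,
              exists2 a : X, npart H x = Some a & npart F x = delta F n a,
            (* f_n is the restriction of delta_{F_n} to ran(H_n) *)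
            forall z : range (@npart X (option X) H n),
              exists2 a : X, val z = Some a & f n z = delta F n a
          & (* g is f_n^{-1}, with its values in ran(H_n) read in X *)
            exists2 g : range (f n) -> X,
              forall z : range (@npart X (option X) H n),
                Some (g (corestrict (f n) z)) = val z
              & quasi_inverse (delta F n) g])
     /\
     (forall (D : nat -> set Y) (g : forall n : nat, D n -> X),
        (forall n : nat, 0 < n -> quasi_inverse (delta F n) (g n)) ->
        exists (H' : seq X -> option X)
               (f' : forall n : nat, range (@npart X (option X) H' n) -> Y),
          (* H'_n = g_n o F_n *)
          (forall n : nat, 0 < n -> forall x : n.-tuple X,
             exists2 y : D n, val y = npart F x & npart H' x = Some (g n y))
          /\ factorization F f')).
Proof.
case: hX => x0; split; last move=> H f fac.
  split=> [[preF ranF] | [H [f fac]]]; last first.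
    split; first exact: factorization_preassociative fac.
    exact: factorization_range_idempotent fac.
  (* Choosing over pairs of an arity and a value yields all selections at once; [x0] is the default
     off the range. *)
  have /choice[g gK] (p : nat * Y) :
      exists a, range (delta F p.1) p.2 -> delta F p.1 a = p.2.
    have [[a _ Fa]|] := pselect (range (delta F p.1) p.2); first by exists a.
    by exists x0.
  exists (lift_selection F (fun n y => g (n, y))).
  apply: lift_selection_factorization => // n x n_gt0.
  by apply: (gK (n, F x)); rewrite [range _]ranF //; apply: imageT.
have preF := factorization_preassociative fac.
have ranF := factorization_range_idempotent fac.
split.
  move=> n n_gt0; have [_ epsH _ Ff] := fac.
  have F_delta (x : n.-tuple X) :
      exists2 a : X, npart H x = Some a & npart F x = delta F n a.
    have [|a Ha] := eps_standardE (x := x) epsH; first by rewrite size_tuple.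
    by exists a; last exact: factorization_delta fac n_gt0 Ha.
  split=> // [z|]; last exact: factorization_quasi_inverse.
  have [x _ Hx] := set_mem (valP z); have [a Ha Fa] := F_delta x.
  exists a; first by rewrite -Hx.
  by rewrite -Fa (Ff n) //=; congr (f n _); apply: val_inj.
move=> D g gQ.
(* The partial [g n] is extended to all of [Y], with default [x0] outside [D n], so that
   [lift_selection] applies. *)
pose g' n y :=
  if pselect (D n y) is left Dy then g n (SigSub (mem_set Dy)) else x0.
have g'E n (y : D n) : g' n (val y) = g n y.
  rewrite /g'; case: pselect => [Dy|]; last by case; apply: set_mem (valP y).
  by congr (g n _); apply: val_inj.
(* [D n] contains the range of [delta F n], which is that of F_n by quasi-range-idempotence, so the
   default is never reached on values of F_n. *)
have DF n (x : n.-tuple X) : 0 < n -> exists y : D n, val y = F x.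
  move=> n_gt0; have [rD _ _] := gQ n n_gt0.
  have DFx : D n (F x) by apply: rD; rewrite ranF //; apply: imageT.
  by exists (SigSub (mem_set DFx)).
have [|f' facf'] := lift_selection_factorization (g := g') preF.
  move=> n x n_gt0; have [y yF] := DF n x n_gt0; rewrite -yF g'E.
  have [_ gK _] := gQ n n_gt0; apply: gK.
  by rewrite yF ranF //; apply: imageT.
exists (lift_selection F g'), f'; split=> // n n_gt0 x.
have [y yF] := DF n x n_gt0; exists y => //.
by rewrite /npart lift_selectionE // -yF g'E.
Qed.
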